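(* For any $s\in(0,\infty]$, the algebra $\mathscr{A}_s$ is not holomorphically finitely generated (not an HFG algebra).
   Context: Algebras are associative unital algebras over $\mathbb{C}$; homomorphisms are unital. The algebras $\mathscr{A}_s$. For $0\le s<\infty$, $$\mathscr{A}_s:=\Bigl\{a=\sum_{n=0}^\infty a_ny^n:\ \|a\|_{r,s}:=\sum_{n=0}^\infty|a_n|\frac{r^n}{n!^s}<\infty\ \ \forall r>0\Bigr\},$$ an algebra of formal power series in one variable $y$ (with multiplication of power series), topologized by the seminorms $\|\cdot\|_{r,s}$, $r>0$. Further, $\mathscr{A}_\infty:=\mathbb{C}[[y]]$ with the topology given by the seminorms $\|a\|_{m,\infty}:=\sum_{n=0}^m|a_n|$, $m\in\mathbb{Z}_+$. An Arens--Michael algebra is a complete (Hausdorff) locally convex algebra whose topology is generated by a family of submultiplicative seminorms ($\|ab\|\le\|a\|\,\|b\|$). The algebra of free entire functions with generators $\zeta_1,\dots,\zeta_m$ is $$\Bigl\{a=\sum_{\alpha\in W_m}c_\alpha\zeta_\alpha:\ \|a\|_\rho=\sum_{\alpha\in W_m}|c_\alpha|\rho^{|\alpha|}<\infty\ \ \forall\rho>0\Bigr\},\qquad c_\alpha\in\mathbb{C},$$ where $W_m$ is the set of all words (including the empty one) in the alphabet $\{1,\dots,m\}$, $|\alpha|$ is the length of $\alpha$, $\zeta_\alpha$ is the monomial corresponding to $\alpha$, the multiplication extends concatenation of words, and the topology is given by the norms $\|\cdot\|_\rho$. A Fréchet--Arens--Michael algebra is holomorphically finitely generated (HFG) if it is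 topologically isomorphic to the quotient of the algebra of free entire functions with finitely many generators by some closed two-sided ideal. *)

(* Defs.v *)
From HB Require Import structures.
From mathcomp Require Import all_boot all_order all_algebra.
From mathcomp Require Import finmap complex.
From mathcomp Require Import generic_quotient ring_quotient.
From mathcomp Require Import all_classical all_reals all_analysis.
Import Order.TTheory GRing.Theory Num.Theory numFieldNormedType.Exports.

Set Implicit Arguments.
Unset Strict Implicit.
Unset Printing Implicit Defensive.

Local Open Scope classical_set_scope.
Local Open Scope ring_scope.
Local Open Scope complex_scope.

(* The modulus of a complex number, as an element of R (in MathComp [`|z|] is
   an element of R[i]). *)
Local Notation normc := ComplexField.Normc.normc.

(* A monoid in which every element has finitely many factorizations, so that
   formal series indexed by it can be multiplied by convolution.  The two
   instances are (nat, +), indexing formal power series in one variable y, and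
   (seq T, ++), indexing noncommutative formal series in the letters of T. *)
HB.mixin Record isFactMonoid M & Choice M := {
  fmone : M;
  fmmul : M -> M -> M;
  factors : M -> seq (M * M);
  fmmulA : associative fmmul;
  fmmul1m : left_id fmone fmmul;
  fmmulm1 : right_id fmone fmmul;
  factors_uniq : forall u, uniq (factors u);
  mem_factors : forall u p, (p \in factors u) = (fmmul p.1 p.2 == u)
}.

#[short(type="factMonoid")]
HB.structure Definition FactMonoid := {M of Choice M & isFactMonoid M}.

Section NatWords.

Definition nat_factors (n : nat) := [seq (i, n - i)%N | i <- iota 0 n.+1].

Fact nat_factors_uniq n : uniq (nat_factors n).
Proof. by rewrite map_inj_uniq ?iota_uniq// => i j []. Qed.

Fact mem_nat_factors n p : (p \in nat_factors n) = ((p.1 + p.2)%N == n).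
Proof.
case: p => i j /=; apply/mapP/eqP => [[k]|<-].
  by rewrite mem_iota ltnS => /= kn [-> ->]; rewrite subnKC.
by exists i; rewrite ?mem_iota ?ltnS ?leq_addr// addKn.
Qed.

HB.instance Definition _ := isFactMonoid.Build nat
  addnA add0n addn0 nat_factors_uniq mem_nat_factors.

Variable T : choiceType.

Definition word_factors (u : seq T) :=
  [seq (take i u, drop i u) | i <- iota 0 (size u).+1].

Fact word_factors_uniq u : uniq (word_factors u).
Proof.
rewrite map_inj_in_uniq ?iota_uniq// => i j.
rewrite !mem_iota !ltnS/= => iu ju [/(congr1 size)].
by rewrite !size_take_min !(minn_idPl _).
Qed.

Fact mem_word_factors u p : (p \in word_factors u) = (p.1 ++ p.2 == u).
Proof.
case: p => v w /=; apply/mapP/eqP => [[k _ [-> ->]]|<-].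
  by rewrite cat_take_drop.
exists (size v); first by rewrite mem_iota size_cat /= add0n ltnS leq_addr.
by rewrite take_size_cat// drop_size_cat.
Qed.

HB.instance Definition _ := isFactMonoid.Build (seq T)
  (@catA T) (@cat0s T) (@cats0 T) word_factors_uniq mem_word_factors.

End NatWords.

Section Convolution.
Context (K : comPzRingType) (M : factMonoid).
Implicit Types a b c : M -> K.

Definition conv a b : M -> K :=
  fun u => \sum_(p <- factors u) a p.1 * b p.2.

Definition conv1 : M -> K := fun u => (u == fmone)%:R.

Lemma convA : associative conv.
Proof.
move=> a b c; apply/funext => u; rewrite /conv.
under eq_bigr do rewrite mulr_sumr.
under [RHS]eq_bigr do rewrite mulr_suml.
pose F (t : M * M * M) := a t.1.1 * b t.1.2 * c t.2.
transitivity (\sum_(t <- [seq (p.1, q.1, q.2) | p <- factors u,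
    q <- factors p.2]) F t).
  by rewrite big_allpairs_dep; apply: eq_bigr => p _; apply: eq_bigr => q _;
    rewrite /F mulrA.
transitivity (\sum_(t <- [seq (q.1, q.2, p.2) | p <- factors u,
    q <- factors p.1]) F t); last by rewrite big_allpairs_dep.
apply: perm_big; apply: uniq_perm.
- apply: allpairs_uniq_dep => [|p _|]; [exact: factors_uniq..|].
  move=> _ _ /allpairsPdep[[p1 p2] [[q1 q2] [_ qp ->]]]
    /allpairsPdep[[p1' p2'] [[q1' q2'] [_ qp' ->]]] /=.
  move: qp qp'; rewrite !mem_factors/= => /eqP <- /eqP <-.
  by move=> [-> -> ->].
- apply: allpairs_uniq_dep => [|p _|]; [exact: factors_uniq..|].
  move=> _ _ /allpairsPdep[[p1 p2] [[q1 q2] [_ qp ->]]]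
    /allpairsPdep[[p1' p2'] [[q1' q2'] [_ qp' ->]]] /=.
  move: qp qp'; rewrite !mem_factors/= => /eqP <- /eqP <-.
  by move=> [-> -> ->].
move=> [[x y] z]; apply/allpairsPdep/allpairsPdep.
- move=> [[p1 p2]] [[q1 q2]] []; rewrite !mem_factors/= => /eqP pu /eqP qp.
  move=> [-> -> ->]; exists (fmmul p1 q1, q2), (p1, q1).
  by rewrite !mem_factors/= -fmmulA qp pu !eqxx.
- move=> [[p1 p2]] [[q1 q2]] []; rewrite !mem_factors/= => /eqP pu /eqP qp.
  move=> [-> -> ->]; exists (q1, fmmul q2 p2), (q2, p2).
  by rewrite !mem_factors/= fmmulA qp pu !eqxx.
Qed.

Lemma conv1f : left_id conv1 conv.
Proof.
move=> a; apply/funext => u; rewrite /conv /conv1.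
rewrite (bigD1_seq (fmone, u)) ?factors_uniq//=; last first.
  by rewrite mem_factors/= fmmul1m.
rewrite eqxx mul1r big_seq_cond big1 ?addr0// => -[v w].
rewrite mem_factors/= => /andP[/eqP <-]; have [->|] := eqVneq v fmone.
  by rewrite fmmul1m eqxx.
by rewrite mul0r.
Qed.

Lemma convf1 : right_id conv1 conv.
Proof.
move=> a; apply/funext => u; rewrite /conv /conv1.
rewrite (bigD1_seq (u, fmone)) ?factors_uniq//=; last first.
  by rewrite mem_factors/= fmmulm1.
rewrite eqxx mulr1 big_seq_cond big1 ?addr0// => -[v w].
rewrite mem_factors/= => /andP[/eqP <-]; have [->|] := eqVneq w fmone.
  by rewrite fmmulm1 eqxx.
by rewrite mulr0.
Qed.

Lemma convDl a b c : conv (a \+ b) c = conv a c \+ conv b c.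
Proof.
apply/funext => u; rewrite /conv/= -big_split.
by apply: eq_bigr => p _; rewrite mulrDl.
Qed.

Lemma convDr a b c : conv a (b \+ c) = conv a b \+ conv a c.
Proof.
apply/funext => u; rewrite /conv/= -big_split.
by apply: eq_bigr => p _; rewrite mulrDr.
Qed.

End Convolution.

Section Weights.
Context (R : realType) (M : factMonoid).

(* A family of submultiplicative weights; each of them defines a weighted
   l^1-seminorm on series indexed by M. *)
Record weights := Weights {
  weight : set (M -> R);
  weight_ge0 : forall w, weight w -> forall u, 0 <= w u;
  weightM : forall w, weight w ->
    forall u v, w (fmmul u v) <= w u * w v }.

Definition wnorm (w : M -> R) (a : M -> R[i]) : \bar R :=
  \esum_(u in [set: M]) (normc (a u) * w u)%:E.

Lemma normc_ge0 (z : R[i]) : 0 <= normc z.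
Proof. by case: z => x y; exact: sqrtr_ge0. Qed.

Lemma ler_normcD (x y : R[i]) : normc (x + y) <= normc x + normc y.
Proof. exact: le_normcD. Qed.

Lemma normc_sum (I : Type) (r : seq I) (F : I -> R[i]) :
  normc (\sum_(i <- r) F i) <= \sum_(i <- r) normc (F i).
Proof.
elim/big_rec2: _ => [|i x y _ h]; first by rewrite ComplexField.Normc.normc0.
by apply: (le_trans (ler_normcD _ _)); rewrite lerD2l; exact: h.
Qed.

Lemma wnorm_ge w a (s : seq M) : uniq s ->
  ((\sum_(u <- s) normc (a u) * w u)%:E <= wnorm w a)%E.
Proof.
move=> us; apply: ereal_sup_ubound; exists [set` s].
  by split => //; exact: finite_seq.
by rewrite -fsbig_seq// sumEFin.
Qed.

Lemma wnorm_le w a (B : \bar R) :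
  (forall s : seq M, uniq s -> ((\sum_(u <- s) normc (a u) * w u)%:E <= B)%E) ->
  (wnorm w a <= B)%E.
Proof.
move=> h; apply: ub_ereal_sup => _ [X [finX _] <-].
rewrite fsbig_finite//= sumEFin; apply: h; exact: fset_uniq.
Qed.

End Weights.

Section KotheAlgebra.
Context (R : realType) (M : factMonoid) (W : weights R M).
Implicit Types (a b : M -> R[i]).

(* The series with finite weighted l^1-seminorm for every weight of the family.
   With the seminorms [kothe_norm] below, they form a locally convex algebra. *)
Definition kothe_pred : {pred M -> R[i]} :=
  fun a => `[< forall w, weight W w -> (wnorm w a < +oo)%E >].

Lemma kothe_predP a : reflect (forall w, weight W w -> exists B : R,
    forall s : seq M, uniq s -> \sum_(u <- s) normc (a u) * w u <= B)
  (a \in kothe_pred).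
Proof.
apply: (iffP (asboolP _)) => h w Ww.
  exists (fine (wnorm w a)) => s us.
  rewrite -lee_fin fineK ?wnorm_ge// ge0_fin_numE ?h//.
  by rewrite (le_trans _ (wnorm_ge w a (s := [::]) _))// big_nil.
have [B hB] := h w Ww; apply: (@le_lt_trans _ _ B%:E); last exact: ltry.
by apply: wnorm_le => s /hB; rewrite lee_fin.
Qed.

Lemma kothe_submod : submod_closed kothe_pred.
Proof.
split.
  apply/kothe_predP => w Ww; exists 0 => s _; rewrite big1// => u _.
  by rewrite ComplexField.Normc.normc0 mul0r.
move=> c a b /kothe_predP ha /kothe_predP hb; apply/kothe_predP => w Ww.
have [A hA] := ha w Ww; have [B hB] := hb w Ww.
exists (normc c * A + B) => s us.
apply: (@le_trans _ _ (normc c * (\sum_(u <- s) normc (a u) * w u) +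
   \sum_(u <- s) normc (b u) * w u)); last first.
  by rewrite lerD ?hB// ler_wpM2l ?normc_ge0// hA.
rewrite mulr_sumr -big_split/=; apply: ler_sum => u _.
rewrite mulrA -ComplexField.Normc.normcM -mulrDl.
by rewrite ler_wpM2r ?(weight_ge0 Ww)// ler_normcD.
Qed.

HB.instance Definition _ :=
  GRing.isSubmodClosed.Build R[i] (M -> R[i]) kothe_pred kothe_submod.

Lemma conv_bound w a b A B : weight W w ->
  (forall s : seq M, uniq s -> \sum_(u <- s) normc (a u) * w u <= A) ->
  (forall s : seq M, uniq s -> \sum_(u <- s) normc (b u) * w u <= B) ->
  forall s : seq M, uniq s -> \sum_(u <- s) normc (conv a b u) * w u <= A * B.
Proof.
move=> Ww hA hB s us.
pose L := [seq p | u <- s, p <- factors u].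
pose s1 := undup (map fst L); pose s2 := undup (map snd L).
have w0 := weight_ge0 Ww.
apply: (@le_trans _ _ ((\sum_(u <- s1) normc (a u) * w u) *
   (\sum_(v <- s2) normc (b v) * w v))); last first.
  apply: ler_pM; rewrite ?hA ?hB ?undup_uniq//.
  - by apply: sumr_ge0 => u _; rewrite mulr_ge0 ?normc_ge0.
  - by apply: sumr_ge0 => u _; rewrite mulr_ge0 ?normc_ge0.
pose G (p : M * M) := (normc (a p.1) * w p.1) * (normc (b p.2) * w p.2).
have G0 p : 0 <= G p by rewrite /G !mulr_ge0 ?normc_ge0.
apply: (@le_trans _ _ (\sum_(p <- L) G p)).
  rewrite /L big_allpairs_dep; apply: ler_sum => u _.
  rewrite /conv (le_trans (ler_wpM2r (w0 u) (normc_sum _ _)))//.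
  rewrite mulr_suml big_seq [leRHS]big_seq; apply: ler_sum => -[x y].
  rewrite mem_factors/= => /eqP <-; rewrite ComplexField.Normc.normcM /G/=.
  by rewrite mulrACA ler_wpM2l ?mulr_ge0 ?normc_ge0// (weightM Ww).
have uL : uniq L.
  apply: allpairs_uniq_dep => [//|u _|]; first exact: factors_uniq.
  move=> _ _ /allpairsPdep[u [q [_ qu ->]]]
    /allpairsPdep[u' [q' [_ qu' ->]]] /= qq'.
  move: qu qu'; rewrite -{}qq' !mem_factors => /eqP <- /eqP <-.
  by [].
rewrite mulr_suml; under [leRHS]eq_bigr do rewrite mulr_sumr.
have -> : \sum_(x <- s1) \sum_(y <- s2) normc (a x) * w x * (normc (b y) * w y)
    = \sum_(p <- [seq (x, y) | x <- s1, y <- s2]) G p.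
  by rewrite big_allpairs_dep.
rewrite [leRHS](bigID (mem L))/= -[leLHS]addr0 lerD//; last exact: sumr_ge0.
rewrite -[leRHS]big_filter le_eqVlt; apply/orP; left; apply/eqP/perm_big.
apply: uniq_perm => //.
  rewrite filter_uniq//; apply: allpairs_uniq; rewrite ?undup_uniq//.
  by move=> -[x y] [x' y'] _ _ [-> ->].
move=> -[x y]; rewrite mem_filter; case: (boolP (_ \in L)) => //= pL.
apply/esym/allpairsPdep; exists x, y; split => //; rewrite mem_undup.
  exact: (map_f fst pL).
exact: (map_f snd pL).
Qed.

Lemma kothe_conv a b :
  a \in kothe_pred -> b \in kothe_pred -> conv a b \in kothe_pred.
Proof.
move=> /kothe_predP ha /kothe_predP hb; apply/kothe_predP => w Ww.
have [A hA] := ha w Ww; have [B hB] := hb w Ww.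
by exists (A * B); exact: conv_bound.
Qed.

Lemma kothe_conv1 : @conv1 R[i] M \in kothe_pred.
Proof.
apply/kothe_predP => w Ww; exists (w fmone) => s us; rewrite /conv1.
have [ins|nin] := boolP (fmone \in s).
  rewrite (bigD1_seq fmone)//= eqxx ComplexField.Normc.normc1 mul1r.
  rewrite big1 ?addr0// => u /negPf ->.
  by rewrite ComplexField.Normc.normc0 mul0r.
rewrite big_seq big1 ?(weight_ge0 Ww)// => u us'.
case: eqP => [e|_]; first by rewrite -e us' in nin.
by rewrite ComplexField.Normc.normc0 mul0r.
Qed.

Record kothe := Kothe { coef :> M -> R[i]; _ : coef \in kothe_pred }.

HB.instance Definition _ := [isSub for coef].
HB.instance Definition _ := [Choice of kothe by <:].
HB.instance Definition _ := [SubChoice_isSubLmodule of kothe by <:].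

Lemma coefP (x : kothe) : (x : M -> R[i]) \in kothe_pred.
Proof. exact: (valP x). Qed.

Definition kothe_one : kothe := Kothe kothe_conv1.
Definition kothe_mul (x y : kothe) : kothe :=
  Kothe (kothe_conv (coefP x) (coefP y)).

Fact kothe_mulA : associative kothe_mul.
Proof. by move=> x y z; apply: val_inj; exact: convA. Qed.
Fact kothe_mul1x : left_id kothe_one kothe_mul.
Proof. by move=> x; apply: val_inj; exact: conv1f. Qed.
Fact kothe_mulx1 : right_id kothe_one kothe_mul.
Proof. by move=> x; apply: val_inj; exact: convf1. Qed.
Fact kothe_mulDl : left_distributive kothe_mul +%R.
Proof. by move=> x y z; apply: val_inj; exact: convDl. Qed.
Fact kothe_mulDr : right_distributive kothe_mul +%R.
Proof. by move=> x y z; apply: val_inj; exact: convDr. Qed.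
Fact kothe_one_neq0 : kothe_one != 0.
Proof.
apply/eqP => /(congr1 val) /= /(congr1 (fun f => f fmone)).
by rewrite /conv1 eqxx => /eqP; rewrite oner_eq0.
Qed.

HB.instance Definition _ := GRing.Zmodule_isNzRing.Build kothe
  kothe_mulA kothe_mul1x kothe_mulx1 kothe_mulDl kothe_mulDr kothe_one_neq0.

Fact kothe_scaleAl (c : R[i]) (x y : kothe) : c *: (x * y) = (c *: x) * y.
Proof.
apply: val_inj; apply/funext => u; rewrite /= /conv [LHS]mulr_sumr.
by apply: eq_bigr => p _; rewrite mulrA.
Qed.
Fact kothe_scaleAr (c : R[i]) (x y : kothe) : c *: (x * y) = x * (c *: y).
Proof.
apply: val_inj; apply/funext => u; rewrite /= /conv [LHS]mulr_sumr.
by apply: eq_bigr => p _; rewrite mulrCA.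
Qed.

HB.instance Definition _ := GRing.Lmodule_isLalgebra.Build R[i] kothe
  kothe_scaleAl.
HB.instance Definition _ := GRing.Lalgebra_isAlgebra.Build R[i] kothe
  kothe_scaleAr.

End KotheAlgebra.

Section Seminorms.
Context (R : realType).

Definition seminorm (V : lmodType R[i]) (p : V -> R) : Prop :=
  (forall x y, p (x + y) <= p x + p y) /\
  (forall (c : R[i]) x, p (c *: x) = normc c * p x).

Definition submultiplicative (A : nzRingType) (p : A -> R) : Prop :=
  forall x y, p (x * y) <= p x * p y.

(* The uniformity of the locally convex topology generated by the seminorms in
   P: basic entourages are given by finitely many seminorms and a radius. *)
Definition seminorm_entourage (V : zmodType) (P : set (V -> R)) :
    set_system (V * V) :=
  [set E | exists F : set (V -> R), exists e : R,
    [/\ finite_set F, F `<=` P, 0 < e &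
        [set xy | forall p, F p -> p (xy.1 - xy.2) < e] `<=` E]].

Context (V : lmodType R[i]) (P : set (V -> R)).
Hypothesis Psemi : forall p, P p -> seminorm p.
Let ent := seminorm_entourage P.

Lemma seminorm0 p : P p -> p 0 = 0.
Proof.
by move=> /Psemi[_ /(_ 0 0)]; rewrite scale0r ComplexField.Normc.normc0 mul0r.
Qed.

Lemma seminormN p x : P p -> p (- x) = p x.
Proof.
move=> /Psemi[_ /(_ (-1) x)].
by rewrite scaleN1r normcN ComplexField.Normc.normc1 mul1r.
Qed.

Lemma seminorm_entourage_filter : Filter ent.
Proof.
split.
- by exists set0, 1; split => //; exact: finite_set0.
- move=> E E' [F [e [finF FP e0 FE]]] [F' [e' [finF' FP' e'0 FE']]].
  exists (F `|` F'), (Num.min e e'); split.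
  + by rewrite finite_setU.
  + by move=> p [/FP|/FP'].
  + by rewrite lt_min e0.
  + move=> xy h; split; [apply: FE|apply: FE'] => p Fp.
      by have := h p (or_introl Fp); rewrite lt_min => /andP[].
    by have := h p (or_intror Fp); rewrite lt_min => /andP[].
- move=> E E' EE' [F [e [finF FP e0 FE]]]; exists F, e; split => //.
  exact: subset_trans FE EE'.
Qed.

Lemma seminorm_entourage_diagonal E : ent E -> diagonal `<=` E.
Proof.
move=> [F [e [finF FP e0 FE]]] [x y] /= xy; apply: FE => p /FP Pp /=.
by have -> : x = y by []; rewrite subrr seminorm0.
Qed.

Lemma seminorm_entourage_inv E : ent E -> ent (E^-1)%relation.
Proof.
move=> [F [e [finF FP e0 FE]]]; exists F, e; split => // -[x y] /= h.
by apply: FE => p Fp /=; rewrite -opprB seminormN; [exact: h|exact: FP].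
Qed.

Lemma seminorm_entourage_split E : ent E ->
  exists2 B, ent B & (B \; B)%relation `<=` E.
Proof.
move=> [F [e [finF FP e0 FE]]].
exists [set xy | forall p, F p -> p (xy.1 - xy.2) < e / 2].
  by exists F, (e / 2); split => //; rewrite divr_gt0.
move=> [x y] [z /= xz zy]; apply: FE => p Fp /=.
rewrite -(subrKA z) (le_lt_trans ((Psemi (FP _ Fp)).1 _ _))//.
by rewrite (splitr e) ltrD ?xz ?zy.
Qed.

End Seminorms.

#[short(type="uniformAlgType")]
HB.structure Definition UniformAlgebra (K : numDomainType) :=
  {A of Uniform A & GRing.Algebra K A}.

Section KotheTopology.
Context (R : realType) (M : factMonoid) (W : weights R M).

Definition kothe_norm (w : M -> R) (x : kothe W) : R := fine (wnorm w x).

Definition kothe_norms : set (kothe W -> R) :=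
  [set kothe_norm w | w in weight W].

Lemma kothe_norm_ge w (x : kothe W) (s : seq M) : weight W w -> uniq s ->
  \sum_(u <- s) normc (x u) * w u <= kothe_norm w x.
Proof.
move=> Ww us; have /asboolP/(_ w Ww) fx := coefP x.
rewrite -lee_fin fineK ?wnorm_ge// ge0_fin_numE ?h//.
by rewrite (le_trans _ (wnorm_ge w x (s := [::]) _))// big_nil.
Qed.

Lemma kothe_norm_le w (x : kothe W) B : weight W w ->
  (forall s : seq M, uniq s -> \sum_(u <- s) normc (x u) * w u <= B) ->
  kothe_norm w x <= B.
Proof.
move=> Ww h; have /asboolP/(_ w Ww) fx := coefP x.
rewrite -lee_fin fineK.
  by apply: wnorm_le => s us; rewrite lee_fin h.
rewrite ge0_fin_numE ?h//.
by rewrite (le_trans _ (wnorm_ge w x (s := [::]) _))// big_nil.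
Qed.

Lemma kothe_norm_ge0 w (x : kothe W) : weight W w -> 0 <= kothe_norm w x.
Proof.
by move=> Ww; have := kothe_norm_ge x (s := [::]) Ww isT; rewrite big_nil.
Qed.

Lemma kothe_normP p : kothe_norms p -> seminorm p /\ submultiplicative p.
Proof.
move=> [w Ww <-]; have w0 := weight_ge0 Ww.
have scale_le (c : R[i]) x : kothe_norm w (c *: x) <= normc c * kothe_norm w x.
  apply: kothe_norm_le => // s us.
  apply: le_trans (ler_wpM2l (normc_ge0 c) (kothe_norm_ge x Ww us)).
  rewrite mulr_sumr; apply: ler_sum => u _.
  by rewrite mulrA -ComplexField.Normc.normcM.
split; [split => [x y|c x]|move=> x y].
- apply: kothe_norm_le => // s us.
  apply: le_trans (lerD (kothe_norm_ge x Ww us) (kothe_norm_ge y Ww us)).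
  rewrite -big_split/=; apply: ler_sum => u _.
  by rewrite -mulrDl ler_wpM2r// ler_normcD.
- apply/eqP; rewrite eq_le scale_le/=.
  have [->|c0] := eqVneq c 0.
    by rewrite ComplexField.Normc.normc0 mul0r kothe_norm_ge0.
  have := scale_le c^-1 (c *: x); rewrite scalerA mulVf// scale1r.
  rewrite ComplexField.Normc.normcV ler_pdivlMl// lt_neqAle normc_ge0 andbT.
  by rewrite eq_sym; apply: contra_neq c0 => /ComplexField.Normc.eq0_normc.
- apply: kothe_norm_le => //; apply: (conv_bound Ww) => s us;
    exact: kothe_norm_ge.
Qed.

Let semi p : kothe_norms p -> seminorm p.
Proof. by move=> /kothe_normP[]. Qed.

HB.instance Definition _ := isUniform.Build (kothe W)
  (@seminorm_entourage_filter R (kothe W) kothe_norms)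
  (seminorm_entourage_diagonal semi)
  (seminorm_entourage_inv semi) (seminorm_entourage_split semi).

Lemma kothe_entourageE :
  @entourage (kothe W) = seminorm_entourage kothe_norms.
Proof. by []. Qed.

End KotheTopology.

Section PowerSeries.
Context (R : realType).

(* [t] finite: the weights n |-> r^n / n!^t, r > 0.
   [s = +oo]: the weights are the indicators of {0, ..., m}, so that the series
   are arbitrary (calA_infty_full) and the seminorms are
   |a_0| + ... + |a_m| (wnorm_nat_trunc).
   The value at -oo is irrelevant, since [calA] requires 0 <= s. *)
Definition calA_weight (s : \bar R) : set (nat -> R) :=
  match s with
  | EFin t => [set (fun n => r ^+ n / n`!%:R `^ t) | r in [set r : R | 0 < r]]
  | +oo%E => [set (fun n => (n <= m)%N%:R) | m in [set: nat]]
  | -oo%E => set0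
  end.

Fact calA_weight_ge0 s w : calA_weight s w -> forall n, 0 <= w n.
Proof.
case: s => [t||] //= [].
  by move=> r /= r0 <- n; rewrite divr_ge0 ?powR_ge0 ?exprn_ge0 ?ltW.
by move=> m _ <- n; rewrite ler0n.
Qed.

Fact calA_weightM s : (0 <= s)%E -> forall w, calA_weight s w ->
  forall n k, w (fmmul n k) <= w n * w k.
Proof.
case: s => [t||] //= s0 w [].
  move=> r /= r0 <- n k; rewrite -[fmmul n k]/(n + k)%N exprD mulrACA -invfM.
  rewrite -powRM ?ler0n// ler_wpM2l ?mulr_ge0 ?exprn_ge0 ?(ltW r0)//.
  rewrite -natrM lef_pV2 ?posrE ?powR_gt0 ?ltr0n ?muln_gt0 ?fact_gt0//.
  rewrite ge0_ler_powR ?nnegrE ?ler0n// ler_nat.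
  rewrite -(@bin_fact (n + k) n) ?leq_addr// addKn leq_pmull//.
  by rewrite bin_gt0 leq_addr.
move=> m _ <- n k; rewrite -[fmmul n k]/(n + k)%N -natrM ler_nat mulnb.
case: (boolP (n + k <= m)%N) => //= h.
by rewrite (leq_trans (leq_addr k n) h) (leq_trans (leq_addl n k) h).
Qed.

Definition calA_weights s (s0 : (0 <= s)%E) : weights R nat :=
  Weights (@calA_weight_ge0 s) (calA_weightM s0).

Definition calA s (s0 : (0 <= s)%E) := kothe (calA_weights s0).

HB.instance Definition _ s (s0 : (0 <= s)%E) := GRing.Algebra.on (calA s0).
HB.instance Definition _ s (s0 : (0 <= s)%E) := Uniform.on (calA s0).

Lemma calA_coefM s (s0 : (0 <= s)%E) (x y : calA s0) n :
  (x * y) n = \sum_(i < n.+1) x i * y (n - i)%N.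
Proof.
rewrite -(big_mkord xpredT (fun i => x i * y (n - i)%N)) /=.
by rewrite /conv big_map.
Qed.

Lemma wnorm_nat (w : nat -> R) (a : nat -> R[i]) : (forall n, 0 <= w n) ->
  wnorm w a = (\sum_(n <oo) (normc (a n) * w n)%:E)%E.
Proof.
move=> w0; rewrite nneseries_esumT// => n.
by rewrite lee_fin mulr_ge0// normc_ge0.
Qed.

Lemma wnorm_nat_trunc (m : nat) (a : nat -> R[i]) :
  wnorm (fun n => (n <= m)%N%:R) a = (\sum_(n < m.+1) normc (a n))%:E.
Proof.
rewrite wnorm_nat => [|n]; last exact: ler0n.
rewrite (@nneseries_split _ _ 0%N m.+1) => [|n _]; last first.
  by rewrite lee_fin mulr_ge0// normc_ge0.
rewrite [X in (_ + X)%E]eseries0 => [|n]; last first.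
  by rewrite add0n ltnNge => /negPf -> _; rewrite mulr0.
rewrite adde0 add0n big_mkord sumEFin; congr EFin; apply: eq_bigr => n _.
by rewrite -ltnS ltn_ord mulr1.
Qed.

Lemma calA_infty_full (s0 : (0 <= +oo)%E) (a : nat -> R[i]) :
  a \in kothe_pred (calA_weights s0).
Proof. by apply/asboolP => w [m _ <-]; rewrite wnorm_nat_trunc ltry. Qed.

End PowerSeries.

Section FreeEntire.
Context (R : realType).

Fact free_weight_ge0 m w :
  [set (fun u : seq 'I_m => r ^+ size u) | r in [set r : R | 0 < r]] w ->
  forall u, 0 <= w u.
Proof. by move=> [r /= r0 <-] u; rewrite exprn_ge0 ?ltW. Qed.

Fact free_weightM m w :
  [set (fun u : seq 'I_m => r ^+ size u) | r in [set r : R | 0 < r]] w ->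
  forall u v, w (fmmul u v) <= w u * w v.
Proof. by move=> [r /= r0 <-] u v; rewrite size_cat exprD. Qed.

(* The weights are alpha |-> rho^|alpha|, rho > 0, alpha a word in m letters. *)
Definition free_weights m : weights R (seq 'I_m) :=
  Weights (@free_weight_ge0 m) (@free_weightM m).

Definition free_entire (m : nat) := kothe (free_weights m).

HB.instance Definition _ m := GRing.Algebra.on (free_entire m).
HB.instance Definition _ m := Uniform.on (free_entire m).

Lemma free_entire_coefM m (x y : free_entire m) (u : seq 'I_m) :
  (x * y) u = \sum_(i < (size u).+1) x (take i u) * y (drop i u).
Proof.
rewrite -(big_mkord xpredT (fun i => x (take i u) * y (drop i u))) /=.
by rewrite /conv big_map.
Qed.

End FreeEntire.

HB.mixin Record isTwoSidedIdeal (B : nzRingType) (I : B -> bool) := {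
  ideal_mull : forall a u : B, u \in I -> a * u \in I;
  ideal_mulr : forall a u : B, u \in I -> u * a \in I
}.

#[short(type="twoSidedIdeal")]
HB.structure Definition TwoSidedIdeal (B : nzRingType) :=
  {I of GRing.ZmodClosed B I & isTwoSidedIdeal B I}.

Section IdealQuotient.
Local Open Scope quotient_scope.
Context (K : comNzRingType) (B : algType K) (I : twoSidedIdeal B).

(* MathComp puts a ring structure on {ideal_quot I} for commutative rings only;
   its Z-module part is reused here.  The ideal I may be improper, hence the
   quotient is only a pzRingType (and an lmodType). *)
Definition ideal_quotient : Type := Quotient.quot I.
Local Notation Q := ideal_quotient.

HB.instance Definition _ := GRing.Zmodule.on Q.
HB.instance Definition _ := Quotient.on Q.

Lemma ideal_quotientE (x y : B) : (\pi_Q x == \pi_Q y) = (x - y \in I).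
Proof. by rewrite (Quotient.idealrBE I). Qed.

Lemma pi_quotD (x y : B) : \pi_Q (x + y) = \pi_Q x + \pi_Q y.
Proof. exact: (Quotient.pi_add I). Qed.

Definition quot_one : Q := \pi_Q 1.
Definition quot_mul : Q -> Q -> Q := lift_op2 Q *%R.
Definition quot_scale (c : K) : Q -> Q := lift_op1 Q ( *:%R c).

Lemma repr_sub (x : B) : repr (\pi_Q x) - x \in I.
Proof. by rewrite -ideal_quotientE reprK. Qed.

Lemma pi_quotM (x y : B) : quot_mul (\pi_Q x) (\pi_Q y) = \pi_Q (x * y).
Proof.
unlock quot_mul; apply/eqP; rewrite ideal_quotientE.
have -> : repr (\pi_Q x) * repr (\pi_Q y) - x * y =
    repr (\pi_Q x) * (repr (\pi_Q y) - y) + (repr (\pi_Q x) - x) * y.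
  by rewrite mulrBr mulrBl addrA subrK.
by apply: rpredD; [apply: ideal_mull|apply: ideal_mulr]; exact: repr_sub.
Qed.

Lemma pi_quotZ (c : K) (x : B) : quot_scale c (\pi_Q x) = \pi_Q (c *: x).
Proof.
unlock quot_scale; apply/eqP; rewrite ideal_quotientE -scalerBr.
by rewrite -[_ - x]mul1r scalerAl; apply: ideal_mull; exact: repr_sub.
Qed.

Fact quot_mulA : associative quot_mul.
Proof.
move=> p q r; rewrite -[p]reprK -[q]reprK -[r]reprK.
by rewrite !pi_quotM mulrA.
Qed.
Fact quot_mul1x : left_id quot_one quot_mul.
Proof. by move=> p; rewrite -[p]reprK pi_quotM mul1r. Qed.
Fact quot_mulx1 : right_id quot_one quot_mul.
Proof. by move=> p; rewrite -[p]reprK pi_quotM mulr1. Qed.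
Fact quot_mulDl : left_distributive quot_mul +%R.
Proof.
move=> p q r; rewrite -[p]reprK -[q]reprK -[r]reprK.
by rewrite !(pi_quotM, =^~ pi_quotD) mulrDl.
Qed.
Fact quot_mulDr : right_distributive quot_mul +%R.
Proof.
move=> p q r; rewrite -[p]reprK -[q]reprK -[r]reprK.
by rewrite !(pi_quotM, =^~ pi_quotD) mulrDr.
Qed.

HB.instance Definition _ := GRing.Zmodule_isPzRing.Build Q
  quot_mulA quot_mul1x quot_mulx1 quot_mulDl quot_mulDr.

Fact quot_scaleA (c d : K) (p : Q) :
  quot_scale c (quot_scale d p) = quot_scale (c * d) p.
Proof. by rewrite -[p]reprK !pi_quotZ scalerA. Qed.
Fact quot_scale1 : left_id 1 quot_scale.
Proof. by move=> p; rewrite -[p]reprK pi_quotZ scale1r. Qed.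
Fact quot_scaleDr : right_distributive quot_scale +%R.
Proof.
move=> c p q; rewrite -[p]reprK -[q]reprK.
by rewrite !(pi_quotZ, =^~ pi_quotD) scalerDr.
Qed.
Fact quot_scaleDl (p : Q) : {morph quot_scale^~ p : c d / c + d}.
Proof.
move=> c d; rewrite -[p]reprK.
by rewrite !(pi_quotZ, =^~ pi_quotD) scalerDl.
Qed.

HB.instance Definition _ := GRing.Zmodule_isLmodule.Build K Q
  quot_scaleA quot_scale1 quot_scaleDr quot_scaleDl.

End IdealQuotient.

HB.instance Definition _ (K : numDomainType) (B : uniformAlgType K)
    (I : twoSidedIdeal B) :=
  Topological.copy (ideal_quotient I) (quotient_topology (Quotient.quot I)).

Section HFG.
Context (R : realType).

(* Complete Hausdorff, with topology generated by a family of submultiplicative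
   seminorms, and metrizable (Frechet). *)
Definition frechet_arens_michael (A : uniformAlgType R[i]) : Prop :=
  [/\ forall F : set_system A, ProperFilter F -> cauchy F ->
        exists x : A, F --> x,
      hausdorff_space A,
      exists2 P : set (A -> R),
        forall p, P p -> seminorm p /\ submultiplicative p &
        @entourage A = seminorm_entourage P
    & countable_uniformity A].

(* [f] is an isomorphism of unital algebras and a homeomorphism; the topology of
   [ideal_quotient I] is the quotient topology. *)
Definition HFG (A : uniformAlgType R[i]) : Prop :=
  frechet_arens_michael A /\
  exists (m : nat) (I : twoSidedIdeal (free_entire R m))
    (f : {linear ideal_quotient I -> A}) (g : A -> ideal_quotient I),
  [/\ closed [set x | x \in I],
      monoid_morphism f, cancel f g /\ cancel g f,
      continuous f & continuous g].

End HFG.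

Section KotheFrechetArensMichael.
Context (R : realType) (M : factMonoid) (W : weights R M).
Hypothesis W_pos : forall u, exists2 w, weight W w & 0 < w u.
Variable (wn : nat -> M -> R).
Hypothesis wnW : forall n, weight W (wn n).
Hypothesis wn_cofinal : forall w, weight W w ->
  exists n, forall u, w u <= wn n u.
Local Notation A := (kothe W).
Implicit Types x y : A.

Let semi w : weight W w -> seminorm (@kothe_norm _ _ W w).
Proof. by move=> Ww; apply: (kothe_normP _).1; exists w. Qed.

Lemma entourage_kothe w (e : R) : weight W w -> 0 < e ->
  entourage [set xy : A * A | kothe_norm w (xy.1 - xy.2) < e].
Proof.
move=> Ww e0; exists [set (@kothe_norm _ _ W w)], e; split => //.
- by move=> _ ->; exists w.
- by move=> xy /(_ _ erefl).
Qed.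

Lemma kothe_normB w x y : weight W w ->
  kothe_norm w (x - y) = kothe_norm w (y - x).
Proof.
move=> Ww; rewrite -opprB (@seminormN _ _ (@kothe_norms _ _ W))//.
  by move=> p /kothe_normP[].
by exists w.
Qed.

Lemma nbhs_kothe w (e : R) x : weight W w -> 0 < e ->
  nbhs x [set y : A | kothe_norm w (x - y) < e].
Proof.
move=> Ww e0; have := nbhs_entourage x (entourage_kothe Ww e0).
by apply: filterS => y /xsectionP.
Qed.

Lemma coef_le w x u : weight W w -> normc (x u) * w u <= kothe_norm w x.
Proof.
by move=> Ww; have := kothe_norm_ge x (s := [:: u]) Ww isT; rewrite big_seq1.
Qed.

Lemma kothe_hausdorff : hausdorff_space A.
Proof.
move=> x y xy; apply: val_inj; apply/funext => u /=.
have [w Ww wu0] := W_pos u; apply/eqP/negPn/negP => xyu.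
have d0 : 0 < normc (x u - y u).
  rewrite lt_neqAle normc_ge0 andbT eq_sym.
  apply: contra_neq xyu => /ComplexField.Normc.eq0_normc/eqP.
  by rewrite subr_eq0 => /eqP.
pose d := normc (x u - y u) * w u.
have d20 : 0 < d / 2 by rewrite divr_gt0// mulr_gt0.
have [z [/= xz yz]] := xy _ _ (nbhs_kothe x Ww d20) (nbhs_kothe y Ww d20).
suff nd : kothe_norm w (x - y) < d.
  have : d < d by exact: le_lt_trans (coef_le (x - y) u Ww) nd.
  by rewrite ltxx.
have -> : x - y = (x - z) + (z - y) by rewrite addrA subrK.
rewrite (le_lt_trans ((semi Ww).1 _ _))// (splitr d) ltrD//.
by rewrite kothe_normB.
Qed.

Lemma kothe_countable : countable_uniformity A.
Proof.
apply/countable_uniformityP.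
exists (fun n => [set xy : A * A | forall i, (i <= n)%N ->
    kothe_norm (wn i) (xy.1 - xy.2) < n.+1%:R^-1]); last first.
  move=> n; exists [set @kothe_norm _ _ W (wn i) | i in `I_n.+1], n.+1%:R^-1.
  split.
  - exact/finite_image/finite_II.
  - by move=> _ [i _ <-]; exists (wn i).
  - by rewrite invr_gt0.
  - by move=> xy h i ni; apply: h; exists i.
move=> E [F [e [finF FP e0 FE]]].
have /choice[k hk] : forall p : A -> R, exists n, F p ->
    forall z, p z <= kothe_norm (wn n) z.
  move=> p; have [Fp|nFp] := pselect (F p); last by exists 0%N.
  have [w Ww <-] := FP _ Fp; have [n hn] := wn_cofinal Ww; exists n => _ z.
  apply: kothe_norm_le => // s us.
  apply: le_trans (kothe_norm_ge z (wnW n) us).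
  by apply: ler_sum => u _; rewrite ler_wpM2l ?normc_ge0.
pose N := (\max_(p <- fset_set F) k p)%N.
pose m := Num.bound e^-1; exists (maxn N m) => xy h; apply: FE => p Fp.
apply: (le_lt_trans (hk p Fp _)).
have kN : (k p <= maxn N m)%N.
  apply: leq_trans (leq_maxl _ _); rewrite /N.
  by apply: leq_bigmax_seq => //; rewrite in_fset_set// inE.
apply: (lt_le_trans (h _ kN)).
rewrite invf_ple ?posrE//; apply: ltW.
apply: (lt_le_trans (archi_boundP _)); first by rewrite invr_ge0 ltW.
by rewrite ler_nat leqW// leq_maxr.
Qed.

Lemma real_cauchy (T : Type) (F : set_system T) (f : T -> R) : ProperFilter F ->
  (forall e : R, 0 < e ->
    exists2 D, F D & forall x y : T, D x -> D y -> `|f x - f y| < e) ->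
  exists l, forall e : R, 0 < e -> F [set x | `|l - f x| < e].
Proof.
move=> FF h; have : cauchy (f @ F).
  apply/cauchy_exP => e e0; have [D FD hD] := h e e0.
  have [x Dx] := filter_ex FD; exists (f x).
  have : F [set y | `|f x - f y| < e].
    by apply: filterS FD => y Dy; exact: hD.
  by [].
move=> /R_complete/cvg_ex[l /cvgrPdist_lt hl]; exists l => e e0.
exact: hl.
Qed.

Lemma ler_re_normc (z : R[i]) : `|complex.Re z| <= normc z.
Proof. by case: z => a b /=; rewrite -sqrtr_sqr ler_wsqrtr// lerDl sqr_ge0. Qed.

Lemma ler_im_normc (z : R[i]) : `|complex.Im z| <= normc z.
Proof. by case: z => a b /=; rewrite -sqrtr_sqr ler_wsqrtr// lerDr sqr_ge0. Qed.

Lemma normc_le_reim (z : R[i]) : normc z <= `|complex.Re z| + `|complex.Im z|.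
Proof.
case: z => a b /=; rewrite -[leRHS]ger0_norm ?addr_ge0// -sqrtr_sqr.
rewrite ler_wsqrtr// sqrrD !real_normK ?num_real//.
by rewrite addrAC lerDl mulrn_wge0// mulr_ge0.
Qed.

Lemma kothe_complete (F : set_system A) : ProperFilter F -> cauchy F ->
  exists x : A, F --> x.
Proof.
move=> FF cF.
have cFw w (e : R) : weight W w -> 0 < e -> exists2 D, F D &
    forall x y, D x -> D y -> kothe_norm w (x - y) < e.
  move=> Ww e0; have [[D1 D2] [/= F1 F2] D12] := cF _ (entourage_kothe Ww e0).
  exists (D1 `&` D2); first exact: filterI.
  by move=> x y [x1 _] [_ y2]; exact: (D12 (x, y)).
have lim_u u : exists l : R[i], forall e,
    0 < e -> F [set x | normc (l - x u) < e].
  have [w Ww wu0] := W_pos u.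
  have [|lr hr] := @real_cauchy _ F (fun x => complex.Re (x u)) FF.
    move=> e e0; have ewu : 0 < e * w u by rewrite mulr_gt0.
    have [D FD hD] := cFw _ _ Ww ewu; exists D => // x y Dx Dy.
    rewrite -raddfB; apply: (le_lt_trans (ler_re_normc _)).
    rewrite -(ltr_pM2r wu0).
    exact: le_lt_trans (coef_le (x - y) u Ww) (hD _ _ Dx Dy).
  have [|li hi] := @real_cauchy _ F (fun x => complex.Im (x u)) FF.
    move=> e e0; have ewu : 0 < e * w u by rewrite mulr_gt0.
    have [D FD hD] := cFw _ _ Ww ewu; exists D => // x y Dx Dy.
    rewrite -raddfB; apply: (le_lt_trans (ler_im_normc _)).
    rewrite -(ltr_pM2r wu0).
    exact: le_lt_trans (coef_le (x - y) u Ww) (hD _ _ Dx Dy).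
  exists (lr +i* li) => e e0; have e20 : 0 < e / 2 by rewrite divr_gt0.
  apply: filterS (filterI (hr _ e20) (hi _ e20)) => x [/= xr xi].
  apply: (le_lt_trans (normc_le_reim _)); rewrite (splitr e) ltrD//.
    by move: xr; case: (x u).
  by move: xi; case: (x u).
have /choice[a ha] := lim_u.
have close w (e : R) x D : weight W w -> F D ->
    (forall y, D y -> kothe_norm w (x - y) < e) ->
    forall s : seq M, uniq s -> \sum_(u <- s) normc (x u - a u) * w u <= e.
  move=> Ww FD hD s us; apply/ler_addgt0Pr => d d0.
  have w0 := weight_ge0 Ww.
  pose S := \sum_(u <- s) w u; have S0 : 0 <= S by exact: sumr_ge0.
  have S1 : 0 < S + 1 by rewrite ltr_wpDl.
  have dS : 0 < d / (S + 1) by rewrite divr_gt0.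
  have Fs : F [set y | forall u, u \in s -> normc (a u - y u) < d / (S + 1)].
    pose G u := [set y : A | normc (a u - y u) < d / (S + 1)].
    have FG : F (\bigcap_(u in [set` [fset u in s]%fset]) G u).
      by apply: filter_bigI => u _; exact: ha.
    by apply: filterS FG => y hy u us'; apply: hy; rewrite /= inE.
  have [y [Dy hy]] := filter_ex (filterI FD Fs).
  apply: (@le_trans _ _ (\sum_(u <- s) normc ((x - y) u) * w u +
     \sum_(u <- s) d / (S + 1) * w u)).
    rewrite -big_split/= big_seq [leRHS]big_seq; apply: ler_sum => u us'.
    rewrite -mulrDl ler_wpM2r//.
    have -> : x u - a u = (x u - y u) + (y u - a u) by rewrite addrA subrK.
    rewrite (le_trans (ler_normcD _ _))// lerD2l -opprB normcN ltW//.
    exact: hy.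
  apply: lerD; first exact: le_trans (kothe_norm_ge _ Ww us) (ltW (hD _ Dy)).
  rewrite -mulr_sumr -/S -mulrA ler_piMr ?(ltW d0)//.
  by rewrite ler_pdivrMl// mulr1 lerDl.
have aP : a \in kothe_pred W.
  apply/kothe_predP => w Ww; have [D FD hD] := cFw w 1 Ww ltr01.
  have [x Dx] := filter_ex FD.
  have hx := close w 1 x D Ww FD (fun y => hD x y Dx).
  exists (kothe_norm w x + 1) => s us.
  apply: le_trans (lerD (kothe_norm_ge x Ww us) (hx s us)).
  rewrite -big_split/=; apply: ler_sum => u _.
  rewrite -mulrDl ler_wpM2r ?(weight_ge0 Ww)//.
  have := ler_normcD (x u) (- (x u - a u)).
  by rewrite normcN opprB addrC subrK.
exists (Kothe aP); apply/cvg_entourageP => E [Fp [e [finF FP e0 FE]]].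
have e20 : 0 < e / 2 by rewrite divr_gt0.
pose G (p : A -> R) := [set y : A | p (Kothe aP - y) < e].
suff FG : F (\bigcap_(p in [set` fset_set Fp]) G p).
  apply: filterS FG => y hy.
  by apply: FE => p pF; apply: hy; rewrite /= in_fset_set// inE.
apply: filter_bigI => p.
rewrite in_fset_set// inE => /FP [w Ww <-].
have [D FD hD] := cFw w _ Ww e20; apply: filterS (FD) => x Dx /=.
apply: (@le_lt_trans _ _ (e / 2)); last first.
  by rewrite ltr_pdivrMr// ltr_pMr// ltr1n.
rewrite kothe_normB//; apply: kothe_norm_le => // s us.
exact: (close w _ x D Ww FD (fun y => hD x y Dx)).
Qed.

Lemma kothe_frechet_arens_michael : frechet_arens_michael A.
Proof.
split; [exact: kothe_complete|exact: kothe_hausdorff| |exact: kothe_countable].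
by exists (@kothe_norms _ _ W); first exact: kothe_normP.
Qed.

End KotheFrechetArensMichael.

Section CalAFAM.
Context (R : realType).

Lemma calA_frechet_arens_michael (s : \bar R) (s0 : (0 <= s)%E) :
  frechet_arens_michael (calA s0).
Proof.
case: s s0 => [t||//] s0.
- apply: (@kothe_frechet_arens_michael _ _ (calA_weights s0) _
    (fun k n => k.+1%:R ^+ n / n`!%:R `^ t)).
  + move=> n; exists (fun n => 1 ^+ n / n`!%:R `^ t).
      by exists 1; rewrite /=.
    by rewrite expr1n divr_gt0// powR_gt0// ltr0n fact_gt0.
  + by move=> k; exists k.+1%:R; rewrite /= ?ltr0n.
  + move=> _ [r /= r0 <-]; exists (Num.bound r) => n.
    rewrite ler_wpM2r ?invr_ge0 ?powR_ge0//.
    apply: lerXn2r; rewrite ?nnegrE ?ler0n ?(ltW r0)//.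
    by rewrite (le_trans (ltW (archi_boundP (ltW r0))))// ler_nat.
- apply: (@kothe_frechet_arens_michael _ _ (calA_weights s0) _
    (fun m n => (n <= m)%N%:R)).
  + by move=> n; exists (fun k => (k <= n)%N%:R); [exists n|rewrite leqnn].
  + by move=> m; exists m.
  + by move=> _ [m _ <-]; exists m.
Qed.

End CalAFAM.

(* Main.v *)
Require Import Defs.
From HB Require Import structures.
From mathcomp Require Import all_boot all_order all_algebra.
From mathcomp Require Import complex.
From mathcomp Require Import generic_quotient ring_quotient.
From mathcomp Require Import ring.
From mathcomp Require Import all_classical all_reals all_analysis.
Import Order.TTheory GRing.Theory Num.Theory numFieldNormedType.Exports.

Local Open Scope classical_set_scope.
Local Open Scope ring_scope.
Local Open Scope complex_scope.

Local Notation normc := ComplexField.Normc.normc.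

(** Suppose that a quotient of the algebra F of free entire functions in
    zeta_1, ..., zeta_m is topologically isomorphic to A_s.  Composing with the
    projection gives a continuous open homomorphism phi from F to A_s.  The
    contradiction is that phi would make A_s a normed space, which it is not.

    Write phi(zeta_i) = a_i + y c_i with a_i complex and c_i in A_s.  This is
    possible because the weights n |-> r^n / n!^s are stable under shifts
    ([calA_shiftable], [shift_decomp]).  Fix a weight w and let D bound the
    norms of all c_i.  Expanding the product phi(zeta_u) for a word u, a term
    that takes the summand y c_i in j places is a multiple of y^j and has norm
    at most L^(|u| - j) D^j |y^j|_w |1|_w, where L bounds the |a_i|.  As s > 0, the
    number D^j |y^j|_w is bounded in j by some B ([calA_quasinilpotent]), so
    |phi(zeta_u)|_w <= B |1|_w (L + 1)^|u| ([word_bound]).  The base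
    rho = L + 1 does not depend on w.  Summing over words, each seminorm
    |phi(x)|_w is at most C_w |x|_rho, for the one norm |.|_rho of F
    ([uniform_bound]).

    By openness, the image of the unit ball of |.|_rho contains a ball of some
    seminorm |.|_w of A_s.  Hence every seminorm of A_s is at most a constant
    times |.|_w.  Evaluated on the monomials y^n this fails: for finite s the
    radii r and 2r give the ratio 2^n, and for s = oo the monomial y^(k+1) is
    annihilated by the k-th seminorm but not by the next one
    ([calA_unbounded], [no_open_hom]). *)

(** * Monomials and approximation in weighted algebras of series *)

Section Monomials.
Set Implicit Arguments.
Unset Strict Implicit.
Context (R : realType) (M : factMonoid) (W : weights R M).
Implicit Types (u v : M) (x y : kothe W) (w : M -> R).

Lemma normc_nat (n : nat) : normc (n%:R : R[i]) = n%:R.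
Proof.
by rewrite -(rmorph_nat (real_complex R)) /= expr0n /= addr0 sqrtr_sqr normr_nat.
Qed.

Lemma sum_indic_le w u (s : seq M) : (forall v, 0 <= w v) -> uniq s ->
  \sum_(v <- s) normc ((v == u)%:R : R[i]) * w v <= w u.
Proof.
move=> w0 us; under eq_bigr do rewrite normc_nat.
have [ins|nin] := boolP (u \in s).
  rewrite (bigD1_seq u)//= eqxx mul1r big1 ?addr0// => v /negPf ->.
  by rewrite mul0r.
rewrite big_seq big1 // => v vs; case: eqP => [e|_]; last by rewrite mul0r.
by rewrite -e vs in nin.
Qed.

Fact monom_subproof u : (fun v => (v == u)%:R : R[i]) \in kothe_pred W.
Proof.
apply/kothe_predP => w Ww; exists (w u) => s us.
exact: sum_indic_le (weight_ge0 Ww) us.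
Qed.

Definition monom u : kothe W := Kothe (monom_subproof u).

Lemma kothe_norm_monom w u : weight W w -> kothe_norm w (monom u) = w u.
Proof.
move=> Ww; apply/eqP; rewrite eq_le; apply/andP; split.
  apply: kothe_norm_le => // s us; exact: sum_indic_le (weight_ge0 Ww) us.
have := coef_le (monom u) u Ww.
by rewrite /= eqxx normc_nat mul1r.
Qed.

Lemma monom1 : monom fmone = 1.
Proof. by apply: val_inj. Qed.

Lemma monomM u v : monom u * monom v = monom (fmmul u v).
Proof.
apply: val_inj; apply/funext => t; rewrite /= /Defs.conv /=.
have [->|tuv] := eqVneq t (fmmul u v).
  rewrite (bigD1_seq (u, v)) ?factors_uniq ?mem_factors//= !eqxx mulr1.
  rewrite big1 ?addr0// => -[p q]; rewrite xpair_eqE negb_and.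
  by case/orP => /negPf ->; rewrite ?mul0r ?mulr0.
rewrite big_seq big1// => -[p q]; rewrite mem_factors/= => /eqP pq.
have [pu|_] := eqVneq p u; last by rewrite mul0r.
have [qv|_] := eqVneq q v; last by rewrite mulr0.
by rewrite -pq pu qv eqxx in tuv.
Qed.

Definition trunc (s : seq M) x := \sum_(u <- s) x u *: monom u.

Lemma coef_trunc s x v : uniq s -> trunc s x v = if v \in s then x v else 0.
Proof.
rewrite /trunc; elim: s => [|u s IH]; first by rewrite big_nil.
move=> /andP[us /IH h]; rewrite big_cons in_cons.
rewrite -[LHS]/(x u * (v == u)%:R + (\sum_(u <- s) x u *: monom u : kothe W) v).
rewrite h; have [->|vu] /= := eqVneq v u; first by rewrite (negPf us) mulr1 addr0.
by rewrite mulr0 add0r.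
Qed.

(** Take s almost exhausting the supremum that defines the norm of x: any finite
    set of indices disjoint from s then carries little of the norm. *)
Lemma trunc_approx w x (e : R) : weight W w -> 0 < e ->
  exists2 s, uniq s & kothe_norm w (x - trunc s x) <= e.
Proof.
move=> Ww e0.
have [s us hs] : exists2 s, uniq s &
    kothe_norm w x - e < \sum_(u <- s) normc (x u) * w u.
  apply: contrapT => h; suff : kothe_norm w x <= kothe_norm w x - e.
    by rewrite lerDl oppr_ge0 leNgt e0.
  apply: kothe_norm_le => // s us; rewrite leNgt; apply/negP => hs.
  by apply: h; exists s.
exists s => //; apply: kothe_norm_le => // t ut.
rewrite -(lerD2l (\sum_(u <- s) normc (x u) * w u)).
apply: le_trans (_ : kothe_norm w x <= _); last by rewrite -lerBlDr ltW.
have uc : uniq (s ++ [seq u <- t | u \notin s]).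
  rewrite cat_uniq us filter_uniq//= andbT; apply/hasPn => u.
  by rewrite mem_filter => /andP[].
apply: le_trans (kothe_norm_ge x Ww uc).
rewrite big_cat lerD2l big_filter [leRHS]big_mkcond/= le_eqVlt; apply/orP; left.
apply/eqP/eq_bigr => u _.
rewrite -[normc _]/(normc (x u - trunc s x u)) coef_trunc//.
case: (u \in s) => /=; last by rewrite subr0.
by rewrite subrr ComplexField.Normc.normc0 mul0r.
Qed.

(** Ensures that the balls of single norms, rather than of finitely many of
    them, form a basis of neighbourhoods. *)
Definition directed := weight W !=set0 /\ forall w1 w2, weight W w1 ->
  weight W w2 -> exists2 w, weight W w & forall u, w1 u <= w u /\ w2 u <= w u.

Lemma kothe_norm_mono w1 w2 x : weight W w1 -> weight W w2 ->
  (forall u, w1 u <= w2 u) -> kothe_norm w1 x <= kothe_norm w2 x.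
Proof.
move=> W1 W2 w12; apply: kothe_norm_le => // s us.
apply: le_trans (kothe_norm_ge x W2 us); apply: ler_sum => u _.
by rewrite ler_wpM2l ?normc_ge0.
Qed.

Lemma nbhs_kotheP x (E : set (kothe W)) : directed -> nbhs x E ->
  exists w e, [/\ weight W w, 0 < e & forall y, kothe_norm w (x - y) < e -> E y].
Proof.
move=> [[w0 Ww0] dirW]; rewrite -nbhs_entourageE => -[A eA AE].
have [F [e [finF FP e0 FA]]] := eA.
suff [w Ww hw] : exists2 w, weight W w &
    forall p, F p -> forall z, p z <= kothe_norm w z.
  exists w, e; split => // y xy; apply: AE; apply/xsectionP.
  by apply: FA => p Fp /=; apply: le_lt_trans (hw p Fp _) xy.
have [s sF] := (finite_seqP _).1 finF; rewrite {}sF {F finF FA} in FP *.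
elim: s FP => [|p s IH] FP; first by exists w0.
have [|w Ww hw] := IH; first by move=> q qs; apply: FP; rewrite /= in_cons qs orbT.
have [w1 W1 pw1] : kothe_norms p by apply: FP; rewrite /= in_cons eqxx.
have [w2 W2 hw2] := dirW _ _ Ww W1; exists w2 => // q /=; rewrite in_cons.
case/orP => [/eqP -> z|qs z].
  by rewrite -pw1; apply: kothe_norm_mono => // u; have [] := hw2 u.
apply: le_trans (hw q qs z) _.
by apply: kothe_norm_mono => // u; have [] := hw2 u.
Qed.

Let semi w : weight W w -> seminorm (@kothe_norm _ _ W w).
Proof. by move=> Ww; apply: (kothe_normP _).1; exists w. Qed.

Lemma ler_kothe_normD w x y : weight W w ->
  kothe_norm w (x + y) <= kothe_norm w x + kothe_norm w y.
Proof. by move=> /semi[]. Qed.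

Lemma kothe_normZ w (c : R[i]) x : weight W w ->
  kothe_norm w (c *: x) = normc c * kothe_norm w x.
Proof. by move=> /semi[]. Qed.

Lemma ler_kothe_normM w x y : weight W w ->
  kothe_norm w (x * y) <= kothe_norm w x * kothe_norm w y.
Proof. by move=> Ww; apply: (kothe_normP _).2; exists w. Qed.

Lemma ler_kothe_norm_sum w (I : Type) (s : seq I) (F : I -> kothe W) :
  weight W w ->
  kothe_norm w (\sum_(i <- s) F i) <= \sum_(i <- s) kothe_norm w (F i).
Proof.
move=> Ww; elim/big_rec2: _ => [|i a z _ h]; last first.
  by apply: le_trans (ler_kothe_normD _ _ Ww) _; rewrite lerD2l.
by rewrite -(scale0r 0) kothe_normZ// ComplexField.Normc.normc0 mul0r.
Qed.

End Monomials.

(** * Continuous linear maps are controlled by their values on monomials *)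

Section BoundedOnMonomials.
Set Implicit Arguments.
Unset Strict Implicit.
Context (R : realType) (M N : factMonoid) (V : weights R M) (W : weights R N).
Context (phi : {linear kothe V -> kothe W}).

(** For the weighted l^1-norms this holds on finite sums of monomials by the
    triangle inequality.  These are dense, but for the topology of [kothe V]
    and not only for the norm v, so continuity of phi passes the bound to the
    limit. *)
Lemma bounded_on_monom (v : M -> R) (w : N -> R) (C : R) :
  directed V -> continuous phi -> weight V v -> weight W w -> 0 <= C ->
  (forall u, kothe_norm w (phi (monom V u)) <= C * v u) ->
  forall x, kothe_norm w (phi x) <= C * kothe_norm v x.
Proof.
move=> dirV cphi Vv Ww C0 h x; apply/ler_addgt0Pr => e e0.
have [v1 [e1 [Vv1 e10 h1]]] := nbhs_kotheP dirV (cphi x _ (nbhs_kothe _ Ww e0)).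
have e12 : 0 < e1 / 2 by rewrite divr_gt0.
have [s us hs] := trunc_approx x Vv1 e12.
have he : kothe_norm w (phi x - phi (trunc s x)) <= e.
  apply/ltW/h1; apply: le_lt_trans hs _.
  by rewrite ltr_pdivrMr// ltr_pMr// ltr1n.
rewrite -[phi x](subrK (phi (trunc s x))) [X in kothe_norm w X]addrC.
apply: (le_trans (ler_kothe_normD _ _ Ww)); rewrite lerD//.
rewrite /trunc linear_sum/=.
apply: (le_trans (ler_kothe_norm_sum _ _ Ww)).
apply: (le_trans _ (ler_wpM2l C0 (kothe_norm_ge x Vv us))).
rewrite mulr_sumr; apply: ler_sum => u _.
rewrite linearZ/= kothe_normZ// mulrCA.
by rewrite ler_wpM2l ?normc_ge0.
Qed.

End BoundedOnMonomials.

(** * Algebras of power series in one variable *)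

Section PowerSeriesAlgebra.
Set Implicit Arguments.
Unset Strict Implicit.
Context (R : realType) (W : weights R nat).
Implicit Types (x y : kothe W).

Lemma coefM_nat x y n : (x * y) n = \sum_(i < n.+1) x i * y (n - i)%N.
Proof.
rewrite -(big_mkord xpredT (fun i => x i * y (n - i)%N)) /=.
by rewrite /Defs.conv big_map.
Qed.

Lemma kothe_nat_mulC x y : x * y = y * x.
Proof.
apply: val_inj; apply/funext => n.
rewrite -[LHS]/((x * y) n) -[RHS]/((y * x) n) !coefM_nat.
rewrite (reindex_inj rev_ord_inj) /=; apply: eq_bigr => i _.
have ni : (i <= n)%N by rewrite -ltnS ltn_ord.
by rewrite subSS (subKn ni) mulrC.
Qed.

(** The weights tolerate a shift of the index, so that x - x(0) is divisible by
    y inside the algebra and not only as a formal series. *)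
Definition shiftable := forall w, weight W w ->
  exists C w', weight W w' /\ forall n, w n <= C * w' n.+1.

Lemma shift_subproof x : shiftable -> (fun n => x n.+1) \in kothe_pred W.
Proof.
move=> sW; apply/kothe_predP => w Ww; have [C [w' [Ww' ww']]] := sW w Ww.
exists (`|C| * kothe_norm w' x) => s us.
have us' : uniq (map S s) by rewrite map_inj_uniq//; exact: succn_inj.
apply: le_trans (ler_wpM2l (normr_ge0 C) (kothe_norm_ge x Ww' us')).
rewrite big_map mulr_sumr; apply: ler_sum => n _.
rewrite mulrCA ler_wpM2l ?normc_ge0// (le_trans (ww' n))//.
by rewrite ler_wpM2r ?(weight_ge0 Ww')// ler_norm.
Qed.

Lemma shift_decomp x : shiftable ->
  exists c, x = x 0%N *: 1 + monom W 1%N * c.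
Proof.
move=> sW; exists (Kothe (shift_subproof x sW)).
apply: val_inj; apply/funext => n.
rewrite -[RHS]/(x 0%N * (n == 0%N)%:R +
  (monom W 1%N * Kothe (shift_subproof x sW)) n).
rewrite coefM_nat; case: n => [|n].
  by rewrite big_ord_recl big_ord0 /= mul0r !addr0 mulr1.
rewrite !big_ord_recl/= big1 => [|i _]; last by rewrite mul0r.
by rewrite !mulr0 mul0r mul1r !add0r addr0 subSS subn0.
Qed.

(** Since the norm of y^n is w n, this makes y topologically quasi-nilpotent, in
    contrast to the variable of the algebra of entire functions (s = 0). *)
Definition quasinilpotent_weights := forall w, weight W w -> forall D : R, 0 < D ->
  exists B, forall n, w n * D ^+ n <= B.

(** No single weight dominates all the others up to a constant, even on
    monomials, so the topology of [kothe W] is not that of a normed space. *)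
Definition unbounded_weights := forall w, weight W w ->
  exists2 w', weight W w' & forall C, exists n, C * w n < w' n.

End PowerSeriesAlgebra.

(** * Homomorphisms from free entire functions *)

Section NoOpenHom.
Set Implicit Arguments.
Unset Strict Implicit.
Context (R : realType) (W : weights R nat) (m : nat).
Local Notation F := (free_entire R m).
Local Notation A := (kothe W).

Context (phi : {linear F -> A}).
Hypothesis phiM : GRing.monoid_morphism phi.

(** Induction on the word u, carrying along the number j of factors y already
    collected and the product b of the other factors.  The first letter of u
    either contributes the scalar a i, which costs L, or the factor y * c i,
    which turns j into j.+1 and costs D: this is absorbed by D ^+ j.+1. *)
Lemma word_bound (w : nat -> R) (a : 'I_m -> R[i]) (c : 'I_m -> A) (L D B : R) :
  weight W w -> 0 < D -> (forall n, w n * D ^+ n <= B) ->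
  (forall i, phi (monom _ [:: i]) = a i *: 1 + monom W 1%N * c i) ->
  (forall i, normc (a i) <= L) -> (forall i, kothe_norm w (c i) <= D) ->
  forall u j b, kothe_norm w (monom W j * b * phi (monom _ u)) <=
    B / D ^+ j * (L + 1) ^+ size u * kothe_norm w b.
Proof.
move=> Ww D0 hB hphi hL hD; elim=> [|i u IH] j b.
  have -> : monom (free_weights R m) [::] = 1 by exact: monom1.
  rewrite phiM.1 mulr1 expr0 mulr1; apply: le_trans (ler_kothe_normM _ _ Ww) _.
  rewrite ler_wpM2r ?kothe_norm_ge0// kothe_norm_monom//.
  by rewrite ler_pdivlMr ?exprn_gt0.
have -> : monom (free_weights R m) (i :: u) = monom _ [:: i] * monom _ u.
  by rewrite monomM.
have -> : monom W j * b * phi (monom _ [:: i] * monom _ u) =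
    a i *: (monom W j * b * phi (monom _ u)) +
    monom W j.+1 * (b * c i) * phi (monom _ u).
  rewrite phiM.2 hphi mulrDl mulrDr -scalerAl mul1r -scalerAr; congr (_ + _).
  rewrite !mulrA; congr (_ * _ * _).
  by rewrite -mulrA (kothe_nat_mulC b) mulrA monomM -[fmmul j 1%N]/(j + 1)%N addn1.
apply: le_trans (ler_kothe_normD _ _ Ww) _; rewrite kothe_normZ//.
have L0 : 0 <= L by apply: le_trans (normc_ge0 _) (hL i).
have B0 : 0 <= B.
  by apply: le_trans (hB 0%N); rewrite mulr1 (weight_ge0 Ww).
have -> : B / D ^+ j * (L + 1) ^+ size (i :: u) * kothe_norm w b =
    L * (B / D ^+ j * (L + 1) ^+ size u * kothe_norm w b) +
    B / D ^+ j.+1 * (L + 1) ^+ size u * (kothe_norm w b * D).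
  by rewrite /= !exprS; field; rewrite expf_neq0 gt_eqF.
apply: lerD.
  apply: ler_pM; rewrite ?normc_ge0 ?kothe_norm_ge0 ?hL ?IH//.
apply: le_trans (IH _ _) _.
rewrite ler_wpM2l//.
  by rewrite mulr_ge0 ?exprn_ge0 ?divr_ge0 ?addr_ge0 ?exprn_ge0 ?(ltW D0).
apply: le_trans (ler_kothe_normM _ _ Ww) _.
by rewrite ler_wpM2l ?kothe_norm_ge0.
Qed.

Lemma free_directed : directed (free_weights R m).
Proof.
split; first by exists (fun u => 1 ^+ size u), 1; rewrite /=.
move=> _ _ [r1 /= r10 <-] [r2 /= r20 <-].
exists (fun u => (r1 + r2) ^+ size u); first by exists (r1 + r2); rewrite //= addr_gt0.
move=> u; split; apply: lerXn2r; rewrite ?nnegrE ?addr_ge0 ?(ltW r10) ?(ltW r20)//.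
  by rewrite lerDl ltW.
by rewrite lerDr ltW.
Qed.

(** The point is the order of the quantifiers: one norm v on the source serves
    for all the seminorms of the target. *)
Lemma uniform_bound : shiftable W -> quasinilpotent_weights W -> continuous phi ->
  exists2 v, weight (free_weights R m) v & forall w, weight W w ->
    exists2 C, 0 <= C & forall x, kothe_norm w (phi x) <= C * kothe_norm v x.
Proof.
move=> sW rW cphi.
have [a [c hac]] : exists (a : 'I_m -> R[i]) (c : 'I_m -> A),
    forall i, phi (monom _ [:: i]) = a i *: 1 + monom W 1%N * c i.
  have /choice[c hc] := fun i => shift_decomp (phi (monom _ [:: i])) sW.
  by exists (fun i => phi (monom _ [:: i]) 0%N), c.
pose L := \sum_i normc (a i).
have L0 : 0 <= L by apply: sumr_ge0 => i _; exact: normc_ge0.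
have Vv : weight (free_weights R m) (fun u => (L + 1) ^+ size u).
  by exists (L + 1); rewrite //= ltr_wpDl.
exists (fun u => (L + 1) ^+ size u) => // w Ww.
pose D := \sum_i kothe_norm w (c i) + 1.
have D0 : 0 < D by rewrite ltr_wpDl// sumr_ge0// => i _; exact: kothe_norm_ge0.
have [B hB] := rW w Ww D D0.
have B0 : 0 <= B.
  by apply: le_trans (hB 0%N); rewrite mulr1 (weight_ge0 Ww).
have C0 : 0 <= B * w 0%N by rewrite mulr_ge0 ?(weight_ge0 Ww).
exists (B * w 0%N) => //.
apply: bounded_on_monom => //; first exact: free_directed.
move=> u; have := @word_bound w a c L D B Ww D0 hB hac _ _ u 0%N 1.
have -> : monom W 0%N = 1 by exact: monom1.
rewrite !mul1r expr0 invr1 mulr1 -monom1 kothe_norm_monom// mulrAC; apply.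
  by move=> i; rewrite /L (bigD1 i)//= lerDl sumr_ge0// => k _; exact: normc_ge0.
move=> i; rewrite /D (bigD1 i)//= -addrA lerDl addr_ge0// sumr_ge0// => k _.
exact: kothe_norm_ge0.
Qed.

(** Openness inverts the uniform bound: some seminorm w controls the norms of
    preimages, hence all the seminorms of the target. *)
Lemma no_open_hom : directed W -> shiftable W -> quasinilpotent_weights W ->
  unbounded_weights W -> continuous phi ->
  (forall U : set F, open U -> U 0 -> nbhs (0 : A) (phi @` U)) -> False.
Proof.
move=> dW sW rW nW cphi ophi; have [v Vv hv] := uniform_bound sW rW cphi.
pose U := [set x : F | kothe_norm v x < 1].
have oU : open U.
  rewrite openE => x /= xU; have e0 : 0 < 1 - kothe_norm v x by rewrite subr_gt0.
  apply: filterS (nbhs_kothe x Vv e0) => y /=.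
  rewrite kothe_normB// ltrBrDl => xy; apply: le_lt_trans xy.
  by rewrite -{1}(subrK x y) addrC ler_kothe_normD.
have U0 : U 0.
  by rewrite /U/= -(scale0r 0) kothe_normZ// ComplexField.Normc.normc0 mul0r.
have [w [e [Ww e0 hw]]] := nbhs_kotheP dW (ophi U oU U0).
have [w' Ww' hw'] := nW w Ww; have [C C0 hC] := hv w' Ww'.
have [n hn] := hw' ((C + 1) / e).
have C1 : 0 < C + 1 by rewrite ltr_wpDl.
have wn0 : 0 < w' n.
  apply: le_lt_trans hn; rewrite mulr_ge0 ?(weight_ge0 Ww)// divr_ge0 ?ltW//.
(* t y^n lies in the w-ball of radius e, yet its w'-norm is C + 1, whereas
   elements of phi(U) have w'-norm at most C. *)
pose t := (C + 1) / w' n.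
have t0 : 0 <= t by rewrite divr_ge0 ?ltW.
have nt : normc (t%:C : R[i]) = t.
  by rewrite /= expr0n /= addr0 sqrtr_sqr ger0_norm.
have [|x /= xU hx] := hw (t%:C *: monom W n).
  rewrite sub0r -scaleNr kothe_normZ// normcN nt kothe_norm_monom//.
  by rewrite /t mulrAC ltr_pdivrMr// -ltr_pdivrMl// mulrC mulrAC.
have := hC x; rewrite hx kothe_normZ// nt kothe_norm_monom// /t divfK ?gt_eqF//.
apply/negP; rewrite -ltNge; apply: (@le_lt_trans _ _ C); last by rewrite ltrDl.
by rewrite -[leRHS]mulr1 ler_wpM2l// ltW.
Qed.

End NoOpenHom.

(** * The projection onto the quotient *)

Section Projection.
Set Implicit Arguments.
Unset Strict Implicit.
Context (K : comNzRingType) (B : algType K) (I : twoSidedIdeal B).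

Definition proj (x : B) : ideal_quotient I := (\pi_(ideal_quotient I) x)%qT.

Fact proj_linear : linear proj.
Proof. by move=> c x y; rewrite /proj pi_quotD -pi_quotZ. Qed.

HB.instance Definition _ :=
  GRing.isLinear.Build K B (ideal_quotient I) _ proj proj_linear.

Lemma proj_monoid_morphism : GRing.monoid_morphism proj.
Proof. by split=> [//|x y]; rewrite /proj -pi_quotM. Qed.

End Projection.

Lemma proj_continuous (K : numDomainType) (B : uniformAlgType K)
  (I : twoSidedIdeal B) : continuous (proj I).
Proof. exact: pi_continuous. Qed.

Lemma nbhs_proj (K : numDomainType) (B : uniformAlgType K)
    (I : twoSidedIdeal B) (U : set B) (x : B) :
  open (proj I @^-1` (proj I @` U)) -> U x -> nbhs (proj I x) (proj I @` U).
Proof.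
move=> oU Ux; apply: (@open_nbhs_nbhs (quotient_topology (Quotient.quot I))).
by split; [exact: oU|exists x].
Qed.

(** The saturation of U is a union of translates U + i of U by elements i of
    the ideal.  In the quotient topology this says that the projection is an
    open map. *)
Lemma open_saturation (R : realType) (M : factMonoid) (V : weights R M)
    (I : twoSidedIdeal (kothe V)) (U : set (kothe V)) :
  directed V -> open U -> open (proj I @^-1` (proj I @` U)).
Proof.
move=> dV; rewrite !openE => oU x /= [u Uu ux].
have [w [e [Vw e0 hw]]] := nbhs_kotheP dV (oU u Uu).
apply: filterS (nbhs_kothe x Vw e0) => y /= xy.
exists (u + (y - x)).
  apply: hw; suff -> : u - (u + (y - x)) = x - y by [].
  by rewrite opprD addrA subrr sub0r opprB.
by rewrite linearD linearB /= ux addrC subrK.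
Qed.

(** * The weights of the algebras A_s *)

Section WeightsOfA.
Set Implicit Arguments.
Unset Strict Implicit.
Context (R : realType).

Lemma calA_directed s (s0 : (0 <= s)%E) : directed (calA_weights (R:=R) s0).
Proof.
case: s s0 => [t||//] s0; split.
- by exists (fun n => 1 ^+ n / n`!%:R `^ t), 1; rewrite /=.
- move=> _ _ [r1 /= r10 <-] [r2 /= r20 <-].
  exists (fun n => (r1 + r2) ^+ n / n`!%:R `^ t).
    by exists (r1 + r2); rewrite //= addr_gt0.
  move=> u; split; rewrite ler_wpM2r ?invr_ge0 ?powR_ge0//;
    apply: lerXn2r; rewrite ?nnegrE ?addr_ge0 ?(ltW r10) ?(ltW r20)//.
    by rewrite lerDl ltW.
  by rewrite lerDr ltW.
- by exists (fun n => (n <= 0)%N%:R), 0%N.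
move=> _ _ [m1 _ <-] [m2 _ <-]; exists (fun n => (n <= maxn m1 m2)%N%:R).
  by exists (maxn m1 m2).
by move=> n; rewrite !ler_nat leq_max; case: (n <= m1)%N; case: (n <= m2)%N.
Qed.

Lemma calA_shiftable s (s0 : (0 <= s)%E) : shiftable (calA_weights (R:=R) s0).
Proof.
case: s s0 => [t||//] s0 w /= [].
  (* (n+1)!^t / n!^t = (n+1)^t <= (2^t)^n, which a larger radius absorbs. *)
  move=> r /= r0 <-; pose q := r * 2 `^ t.
  have q0 : 0 < q by rewrite mulr_gt0 ?powR_gt0.
  exists q^-1, (fun n => q ^+ n / n`!%:R `^ t); split; first by exists q.
  move=> n /=; rewrite exprS -[q * _ / _]mulrA mulKf ?gt_eqF//.
  rewrite factS natrM powRM ?ler0n// invfM mulrA.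
  rewrite ler_wpM2r ?invr_ge0 ?powR_ge0// ler_pdivlMr ?powR_gt0//.
  rewrite /q exprMn ler_wpM2l ?exprn_ge0 ?(ltW r0)//.
  rewrite -powR_mulrn ?powR_ge0// -powRrM [t * _]mulrC powRrM powR_mulrn//.
  rewrite ge0_ler_powR ?nnegrE ?exprn_ge0//.
  by rewrite -natrX ler_nat; exact: ltn_expl.
move=> m _ <-; exists 1, (fun n => (n <= m.+1)%N%:R); split; first by exists m.+1.
by move=> n; rewrite mul1r ltnS.
Qed.

Lemma calA_quasinilpotent s (s_gt0 : (0 < s)%E) :
  quasinilpotent_weights (calA_weights (R:=R) (ltW s_gt0)).
Proof.
case: s s_gt0 => [t||//] s0 w /= [].
  move=> r /= r0 <- D D0; have t0 : 0 < t by rewrite -lte_fin.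
  (* (rD)^n / n!^t = (q^n / n!)^t, and q^n / n! is a term of the series of
     exp q. *)
  pose q := (r * D) `^ t^-1; exists (expR q `^ t) => n.
  have rD : 0 < r * D by rewrite mulr_gt0.
  rewrite mulrAC -exprMn ler_pdivrMr ?powR_gt0 ?ltr0n ?fact_gt0//.
  rewrite -powRM ?expR_ge0//.
  have -> : (r * D) ^+ n = (q ^+ n) `^ t.
    rewrite -[q ^+ n]powR_mulrn ?powR_ge0// -powRrM [_%:R * t]mulrC powRrM.
    rewrite /q -(powRrM (r * D)) mulVf ?gt_eqF//.
    by rewrite powRr1 ?(ltW rD)// powR_mulrn// ltW.
  rewrite ge0_ler_powR ?nnegrE ?(ltW t0) ?exprn_ge0 ?mulr_ge0 ?expR_ge0 ?powR_ge0//.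
  rewrite -ler_pdivrMr ?ltr0n ?fact_gt0//.
  case: n => [|n]; first by rewrite expr0 fact0 divr1 -expR0 ler_expR powR_ge0.
  by apply: (le_trans _ (expR_ge1Dxn n (powR_ge0 _ _))); rewrite lerDr.
move=> m _ <- D D0; exists ((D + 1) ^+ m) => n.
case: leqP => nm; last by rewrite mul0r exprn_ge0// addr_ge0// ltW.
rewrite mul1r; apply: le_trans (_ : (D + 1) ^+ n <= _).
  by apply: lerXn2r; rewrite ?nnegrE ?addr_ge0 ?(ltW D0)// lerDl.
by rewrite ler_weXn2l// lerDr ltW.
Qed.

Lemma calA_unbounded s (s0 : (0 <= s)%E) :
  unbounded_weights (calA_weights (R:=R) s0).
Proof.
case: s s0 => [t||//] s0 w /= [].
  move=> r /= r0 <-; exists (fun n => (2 * r) ^+ n / n`!%:R `^ t).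
    by exists (2 * r); rewrite //= mulr_gt0.
  move=> C; exists (Num.bound `|C|); rewrite exprMn -[ltRHS]mulrA.
  rewrite ltr_pM2r ?divr_gt0 ?exprn_gt0 ?powR_gt0 ?ltr0n ?fact_gt0//.
  apply: le_lt_trans (ler_norm C) _.
  apply: lt_trans (archi_boundP (normr_ge0 C)) _.
  by rewrite -natrX ltr_nat; exact: ltn_expl.
move=> m _ <-; exists (fun n => (n <= m.+1)%N%:R); first by exists m.+1.
by move=> C; exists m.+1; rewrite ltnn leqnn mulr0.
Qed.

End WeightsOfA.

Theorem proposition13 (R : realType) (s : \bar R) (s_gt0 : (0 < s)%E) :
  ~ HFG (calA (ltW s_gt0)).
Proof.
move=> [_ [m [I [f [g [_ fM [fg gf] cf cg]]]]]].
pose phi : {linear free_entire R m -> calA (ltW s_gt0)} := f \o proj I.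
have phiM : GRing.monoid_morphism phi.
  have pM := proj_monoid_morphism I.
  by split=> [|x y]; rewrite /= ?pM.1 ?fM.1// pM.2 fM.2.
apply: (@no_open_hom R (calA_weights (ltW s_gt0)) m phi phiM).
- exact: calA_directed.
- exact: calA_shiftable.
- exact: calA_quasinilpotent.
- exact: calA_unbounded.
- by move=> x U /cf; exact: proj_continuous.
move=> U oU U0.
have g0 : g 0 = proj I 0 by rewrite -(fg (proj I 0)) !linear0.
have : nbhs (g 0) (proj I @` U).
  rewrite g0; apply: nbhs_proj => //.
  exact: open_saturation (@free_directed R m) oU.
move=> /cg; apply: (@filterS (kothe (calA_weights (ltW s_gt0)))).
by move=> y [x Ux xy]; exists x; rewrite //= xy gf.
Qed.
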